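(* Let $X = \mathbb{P}^2$ be the complex projective plane with homogeneous coordinates $[x_0 : x_1 : x_2]$, and let $D_i$ be the divisor defined by $x_i = 0$, for $i \in \{0,1,2\}$. Then the log smooth pair $(X, D)$ is toric log del Pezzo if and only if $$D \in \{D_0, \, D_1, \, D_2\} \cup \{D_0 + D_1, \, D_0 + D_2, \, D_1 + D_2\}.$$
   Context: $\mathbb{P}^2$ is regarded as a toric surface with its standard torus $T \simeq (\mathbb{C}^{\ast})^2$ (the complement of $D_0 \cup D_1 \cup D_2$); its irreducible torus-invariant curves are $D_0, D_1, D_2$. $K_X$ denotes the canonical divisor of $X$. In a log smooth pair $(X, D)$, $X$ is a smooth surface and $D$ is a reduced simple normal crossing divisor on $X$. The pair is called a log smooth del Pezzo pair if $-(K_X + D)$ is ample. It is called toric (so that a toric log smooth del Pezzo pair is called toric log del Pezzo) if moreover $X$ is toric and the logarithmic tangent sheaf $T_X(-\log D)$ is an equivariant sheaf, which means that $D$ is an invariant divisor under the action of the torus $T$ of $X$.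
   Formalization: The divisor D is assumed nonzero: for D = 0 the pair (P^2, 0) is also toric log del Pezzo by the stated definitions (-K is ample, the empty boundary is snc and invariant), yet 0 is not in the list. *)

(* Defs.v *)
From HB Require Import structures.
From mathcomp Require Import all_boot all_order all_algebra.
From mathcomp Require Import boolp reals complex.
From mathcomp Require Import freeg mpoly.

Set Implicit Arguments.
Unset Strict Implicit.
Unset Printing Implicit Defensive.

Import GRing.Theory Num.Theory.
Local Open Scope ring_scope.

(* Everything takes place on the projective plane over an algebraically closed
   field C of characteristic 0 with homogeneous coordinates 'X_0, 'X_1, 'X_2.
   A point is given by homogeneous coordinates, i.e. by a nonzero v : 'rV[C]_3,
   and two such rows give the same point iff they are proportional. *)

Notation hpoly C := {mpoly C[3]}.

(* The function field of the affine cone over the plane; the function field of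
   the plane is its subfield of elements that are homogeneous of degree 0
   (see is_ratfun). *)
Notation hfrac C := {fraction {mpoly C[3]}}.

Notation "x %:F" := (@tofrac _ x) : ring_scope.

Definition proportional (C : numClosedFieldType) (n : nat) (u v : 'rV[C]_n) :
    Prop :=
  exists c : C, u = c *: v.

Definition heval (C : numClosedFieldType) (p : hpoly C) (v : 'rV[C]_3) : C :=
  p.@[fun i => v 0 i].

Definition hgrad (C : numClosedFieldType) (p : hpoly C) (v : 'rV[C]_3) :
    'rV[C]_3 :=
  \row_i heval (p^`M(i)) v.

Definition mirreducible (C : numClosedFieldType) (p : hpoly C) : Prop :=
  [/\ p != 0, p \isn't a GRing.unit &
      forall q r : hpoly C, p = q * r ->
        q \is a GRing.unit \/ r \is a GRing.unit].

(* An integral curve in the plane has an irreducible homogeneous equation,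
   unique up to a nonzero scalar; the curve is represented by its equation with
   leading coefficient 1. *)
Definition is_prime_eq (C : numClosedFieldType) (p : hpoly C) : bool :=
  `[< [/\ mirreducible p, exists d : nat, p \is d.-homog & mleadc p = 1] >].

Record prime_divisor (C : numClosedFieldType) := PrimeDivisor {
  equation :> hpoly C;
  equationP : is_prime_eq equation }.

HB.instance Definition _ (C : numClosedFieldType) :=
  [isSub for @equation C].
HB.instance Definition _ (C : numClosedFieldType) :=
  [Choice of prime_divisor C by <:].

Notation divisor C := {freeg (prime_divisor C) / int}.

Lemma mirreducibleX (C : numClosedFieldType) (i : 'I_3) :
  mirreducible ('X_i : hpoly C).
Proof.
have sX : msize ('X_i : hpoly C) = 2 by rewrite msizeX mdeg1.
have X0 : ('X_i : hpoly C) != 0 by rewrite -msize_poly_eq0 sX.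
have unitE (p : hpoly C) : msize p = 1%N -> p \is a GRing.unit.
  move=> /eqP/msize_poly1P[c c0 ->].
  by apply: rmorph_unit; rewrite unitfE.
split=> // [|q r qr].
  apply/negP => /mulVr XV.
  have V0 : ('X_i : hpoly C)^-1 != 0.
    by apply/eqP=> V0; move/eqP: XV; rewrite V0 mul0r eq_sym oner_eq0.
  have := msizeM V0 X0; rewrite XV msize1 sX addn2 /= => -[] /esym/eqP.
  by rewrite msize_poly_eq0 (negPf V0).
have /andP[q0 r0] : (q != 0) && (r != 0) by rewrite -negb_or -mulf_eq0 -qr.
have := msizeM q0 r0; rewrite -qr sX.
move: q0 r0; rewrite -!msize_poly_eq0.
case Eq : (msize q) => [|[|a]] // _.
  by move=> _ _; left; apply: unitE.
case Er : (msize r) => [|[|b]] // _.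
  by move=> _; right; apply: unitE.
by rewrite !addSn !addnS.
Qed.

Lemma is_prime_eqX (C : numClosedFieldType) (i : 'I_3) :
  is_prime_eq ('X_i : hpoly C).
Proof.
apply/asboolP; split; first exact: mirreducibleX.
  by exists 1%N; rewrite dhomogX /= mdeg1.
by rewrite mleadXm mcoeffX eqxx.
Qed.

Definition coord_line (C : numClosedFieldType) (i : 'I_3) : prime_divisor C :=
  PrimeDivisor (is_prime_eqX C i).

Definition coord_divisor (C : numClosedFieldType) (i : 'I_3) : divisor C :=
  << coord_line C i >>.

Definition reduced_divisor (C : numClosedFieldType) (D : divisor C) : Prop :=
  forall P : prime_divisor C, P \in dom D -> coeff P D = 1.

(* The gradients at v of the equations vanishing at v are the images of the
   local equations in the cotangent space of the plane at v, i.e. in the linear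
   forms killing v (Euler).  Their independence says that the local equations
   are part of a regular system of parameters: all components are smooth, and
   they cross normally. *)
Definition snc (C : numClosedFieldType) (D : divisor C) : Prop :=
  forall v : 'rV[C]_3, v != 0 ->
    free [seq hgrad P v | P : prime_divisor C <- dom D & heval P v == 0].

Definition log_smooth (C : numClosedFieldType) (D : divisor C) : Prop :=
  reduced_divisor D /\ snc D.

Definition is_ratfun (C : numClosedFieldType) (f : hfrac C) : Prop :=
  exists d : nat, exists a b : hpoly C,
    [/\ a \is d.-homog, b \is d.-homog, b != 0 & f = a%:F / b%:F].

Definition mdivides (C : numClosedFieldType) (p q : hpoly C) : Prop :=
  exists r : hpoly C, q = p * r.

(* f has order n along P.  The order is taken on the cone: it restricts to the
   order on the plane, since the equation of P divided by a power of a linear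
   form other than it is a uniformizer along P. *)
Definition has_order (C : numClosedFieldType) (P : prime_divisor C)
    (f : hfrac C) (n : int) : Prop :=
  exists a b : hpoly C,
    [/\ ~ mdivides P a, ~ mdivides P b &
        f = (equation P)%:F ^ n * (a%:F / b%:F)].

(* Differential forms are pulled back to the cone: a 1-form is the row of its
   coefficients on the dx_i, a 2-form is the skew-symmetric matrix of its
   coefficients on the dx_i /\ dx_j. *)

(* d(a / b) *)
Definition dquot (C : numClosedFieldType) (a b : hpoly C) : 'rV[hfrac C]_3 :=
  \row_i ((b * a^`M(i) - a * b^`M(i))%:F / (b ^+ 2)%:F).

Definition wedge (C : numClosedFieldType) (u v : 'rV[hfrac C]_3) :
    'M[hfrac C]_3 :=
  u^T *m v - v^T *m u.

(* d(x_j / x_i) /\ d(x_k / x_i) for {i, j, k} = {0, 1, 2} and j < k, which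
   generates the 2-forms on the affine chart x_i != 0. *)
Definition chart_form (C : numClosedFieldType) (i : 'I_3) : 'M[hfrac C]_3 :=
  wedge (dquot 'X_(fintype.lift i (0 : 'I_2)) 'X_i)
        (dquot 'X_(fintype.lift i (1 : 'I_2)) 'X_i).

(* K is the divisor of the nonzero rational 2-form w.  The curve P meets the
   chart x_i != 0 iff it is not the line x_i = 0. *)
Definition is_div_form (C : numClosedFieldType) (w : 'M[hfrac C]_3)
    (K : divisor C) : Prop :=
  forall i : 'I_3, exists h : hfrac C,
    [/\ is_ratfun h, h != 0, w = h *: chart_form C i &
        forall P : prime_divisor C, P != coord_line C i ->
          has_order P h (coeff P K)].

Definition canonical_divisor (C : numClosedFieldType) (K : divisor C) : Prop :=
  exists w : 'M[hfrac C]_3, is_div_form w K.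

(* f = 0 or div f + E >= 0, i.e. f is a global section of O(E) *)
Definition in_linear_space (C : numClosedFieldType) (E : divisor C)
    (f : hfrac C) : Prop :=
  is_ratfun f /\
  (f = 0 \/
   forall P : prime_divisor C,
     exists n : int, has_order P f n /\ 0 <= n + coeff P E).

(* The product of the equations of the components of E, with multiplicities;
   multiplication by it identifies O(E) with the homogeneous functions of
   degree deg E on the cone. *)
Definition div_equation (C : numClosedFieldType) (E : divisor C) : hfrac C :=
  \prod_(P <- dom E) (equation P)%:F ^ coeff P E.

Definition global_section (C : numClosedFieldType) (E : divisor C)
    (h : hpoly C) : Prop :=
  exists f : hfrac C, in_linear_space E f /\ h%:F = f * div_equation E.

Definition proj_map (C : numClosedFieldType) (N : nat)
    (h : 'I_N -> hpoly C) (v : 'rV[C]_3) : 'rV[C]_N :=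
  \row_j heval (h j) v.

Definition proj_jacobian (C : numClosedFieldType) (N : nat)
    (h : 'I_N -> hpoly C) (v : 'rV[C]_3) : 'M[C]_(3, N) :=
  \matrix_(i, j) heval ((h j)^`M(i)) v.

(* For forms h_j of the same degree: [h_0 : ... : h_N] is everywhere defined,
   injective, and has injective differential
   C^3 / <v> -> C^N.+1 / <proj_map h v> at every point v. *)
Definition is_embedding (C : numClosedFieldType) (N : nat)
    (h : 'I_N.+1 -> hpoly C) : Prop :=
  [/\ forall v : 'rV[C]_3, v != 0 -> proj_map h v != 0,
      forall u v : 'rV[C]_3, u != 0 -> v != 0 ->
        proportional (proj_map h u) (proj_map h v) -> proportional u v &
      forall v w : 'rV[C]_3, v != 0 ->
        proportional (w *m proj_jacobian h v) (proj_map h v) ->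
        proportional w v].

Definition very_ample (C : numClosedFieldType) (E : divisor C) : Prop :=
  exists N : nat, exists h : 'I_N.+1 -> hpoly C,
    (forall j, global_section E (h j)) /\ is_embedding h.

Definition ample (C : numClosedFieldType) (E : divisor C) : Prop :=
  exists m : nat, (0 < m)%N /\ very_ample (E *+ m).

(* Pull-back of an equation by [x_0 : x_1 : x_2] |->
   [t_0 x_0 : t_1 x_1 : t_2 x_2]; the torus is (C^* )^3 modulo the scalars,
   which act trivially. *)
Definition torus_pullback (C : numClosedFieldType) (t : 'rV[C]_3)
    (p : hpoly C) : hpoly C :=
  p \mPo [tuple t 0 i *: 'X_i | i < 3].

Definition torus_invariant (C : numClosedFieldType) (D : divisor C) : Prop :=
  forall t : 'rV[C]_3, (forall i, t 0 i != 0) ->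
  forall P Q : prime_divisor C,
    (exists c : C, torus_pullback t P = c *: equation Q) ->
    coeff P D = coeff Q D.

(* Ampleness only depends on the linear equivalence class, so the choice of the
   canonical divisor is immaterial. *)
Definition log_smooth_del_Pezzo (C : numClosedFieldType) (D : divisor C) :
    Prop :=
  log_smooth D /\
  exists K : divisor C, canonical_divisor K /\ ample (- (K + D)).

Definition toric_log_del_Pezzo (C : numClosedFieldType) (D : divisor C) :
    Prop :=
  log_smooth_del_Pezzo D /\ torus_invariant D.

(* Main.v *)
From HB Require Import structures.
Require Import Defs.
From mathcomp Require Import all_boot all_order all_algebra.
From mathcomp Require Import boolp reals complex.
From mathcomp Require Import freeg mpoly.
From mathcomp Require Import ring zify.
Set Implicit Arguments.
Unset Strict Implicit.
Unset Printing Implicit Defensive.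
Import Order.TTheory GRing.Theory Num.Theory.
Local Open Scope ring_scope.

(** The argument rests on two facts about the lines [D_0], [D_1], [D_2].

    Torus-invariant curves.  The equation of an integral curve [P] other than a
    coordinate line has two distinct monomials, with different exponents at some
    [x_i].  Multiplying [x_i] by the powers of 2 changes the ratio of their
    coefficients, so [P] has infinitely many translates
    ([torus_invariant_coord]).  The support of an invariant divisor is finite,
    so an invariant reduced [D] is the sum of the lines [D_i] for [i] in a set
    [S] ([torus_invariant_sum]).

    Degree.  The form [dx_1 dx_2 / (x_1 x_2)] has divisor
    [- (D_0 + D_1 + D_2)], so that [K + D_0 + D_1 + D_2] is principal for every
    canonical [K] ([log_canonical_principal]).  If [S] is everything, the
    sections of the multiples of [- (K + D)] are therefore rational functions
    without poles, up to a fixed factor, hence constants ([no_poles_const]);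
    proportional forms define a constant map, not an embedding
    ([log_triangle_not_ample]).  If [S] has one or two elements, [- (K + D)] is,
    for [K = - (D_0 + D_1 + D_2)], the sum of the remaining two or one lines.
    Its sections include all quadratic or all linear forms
    ([global_section_coord_sum]), which embed the plane by the Veronese map or
    the identity.

    Orders along a curve are multiplicative because irreducible forms are prime.
    This is unique factorization in [C[x_0, x_1, x_2]], deduced from Gauss's
    lemma ([factorial_poly]); finding a curve along which a given function has
    a pole also uses that the factors of a form are forms ([homog_factor]). *)

(** * Factorial domains and Gauss's lemma *)

Section Factorial.
Variable A : idomainType.
Implicit Types (a b c p q u : A) (s t : seq A).

Definition divides a b := exists c, b = a * c.

(** Prime elements, as opposed to irreducible ones: Euclid's lemma is part of the
    definition. *)
Definition prime_elt p :=
  [/\ p != 0, p \isn't a GRing.unit &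
      forall a b, divides p (a * b) -> divides p a \/ divides p b].

Definition has_factors a :=
  exists s, (forall p, p \in s -> prime_elt p) /\
    exists2 u, u \is a GRing.unit & a = u * \prod_(p <- s) p.

(** Unique factorization, in the form: every nonzero element is a unit times a
    product of primes. *)
Definition factorial_dom := forall a, a != 0 -> has_factors a.

Lemma divides_mulr a b c : divides a b -> divides a (b * c).
Proof. by case=> d ->; exists (d * c); rewrite mulrA. Qed.

Lemma divides_add a b c : divides a b -> divides a c -> divides a (b + c).
Proof. by case=> x -> [y ->]; exists (x + y); rewrite mulrDr. Qed.

Lemma divides_unit a u : u \is a GRing.unit -> divides a u -> a \is a GRing.unit.
Proof. by move=> uu [c e]; move: uu; rewrite e unitrM => /andP[]. Qed.

Lemma has_factors_unit u : u \is a GRing.unit -> has_factors u.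
Proof. by move=> uu; exists [::]; split=> //; exists u; rewrite // big_nil mulr1. Qed.

Lemma has_factors_prime p : prime_elt p -> has_factors p.
Proof.
move=> pp; exists [:: p]; split=> [q|]; first by rewrite inE => /eqP->.
by exists 1; rewrite ?unitr1 // big_seq1 mul1r.
Qed.

Lemma has_factorsM a b : has_factors a -> has_factors b -> has_factors (a * b).
Proof.
move=> [s [ps [u uu ->]]] [t [pt [v uv ->]]]; exists (s ++ t); split.
  by move=> p; rewrite mem_cat => /orP[/ps|/pt].
by exists (u * v); rewrite ?unitrM ?uu // big_cat /= mulrACA.
Qed.

(** A prime dividing a product of primes can be cancelled from it. *)
Lemma prime_divides_prod p s u : prime_elt p -> (forall q, q \in s -> prime_elt q) ->
    u \is a GRing.unit -> divides p (u * \prod_(q <- s) q) ->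
  exists s' v, [/\ (size s' < size s)%N, (forall q, q \in s' -> prime_elt q),
    v \is a GRing.unit & u * \prod_(q <- s) q = p * (v * \prod_(q <- s') q)].
Proof.
move=> pp; elim: s u => [|q s IH] u ps uu.
  rewrite big_nil mulr1 => /(divides_unit uu) pu.
  by case: pp => _; rewrite pu.
have pq : prime_elt q by apply: ps; rewrite inE eqxx.
have {}ps r : r \in s -> prime_elt r by move=> rs; apply: ps; rewrite inE rs orbT.
rewrite big_cons mulrCA; have [p0 pU pd] := pp; have [q0 qU qd] := pq.
case/pd => [[w qw]|/(IH _ ps uu)[s' [v [ss ps' uv e]]]]; last first.
  exists (q :: s'), v; split=> //; last by rewrite e big_cons; ring.
  by move=> r; rewrite inE => /orP[/eqP->|/ps'].
exists s, (w * u); split=> //; last by rewrite qw !mulrA.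
rewrite unitrM uu andbT.
(* The primes [p] and [q = p * w] are associated, so [w] is a unit. *)
have : divides q (p * w) by exists 1; rewrite mulr1.
case/qd => [[c pc]|[c wc]].
  have := mulf_neq0 p0 q0; move: (qw); rewrite {1}pc -mulrA -{1}[q]mulr1.
  move/(mulfI q0) => /esym e _; apply/unitrP; exists c; split=> //.
  by rewrite mulrC.
move: (qw); rewrite wc mulrCA -{1}[q]mulr1 => /(mulfI q0) /esym e.
by case/negP: pU; apply/unitrP; exists c; split=> //; rewrite mulrC.
Qed.

(** Primes are irreducible. *)
Lemma prime_factor p q r : prime_elt p -> p = q * r ->
  q \is a GRing.unit \/ r \is a GRing.unit.
Proof.
move=> [p0 pU pd] e.
have [|[c qc]|[c rc]] := pd q r; first by exists 1; rewrite mulr1.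
  right; apply/unitrP; exists c; rewrite mulrC; suff -> : r * c = 1 by [].
  by apply: (mulfI p0); rewrite mulr1 {2}e qc; ring.
left; apply/unitrP; exists c; rewrite mulrC; suff -> : q * c = 1 by [].
by apply: (mulfI p0); rewrite mulr1 {2}e rc; ring.
Qed.

(** In a factorial domain, irreducible elements are prime. *)
Lemma irreducible_is_prime p : factorial_dom -> p != 0 -> p \isn't a GRing.unit ->
  (forall q r, p = q * r -> q \is a GRing.unit \/ r \is a GRing.unit) ->
  prime_elt p.
Proof.
move=> fA p0 pU irr; have [s [ps [u uu e]]] := fA p p0.
case: s ps e => [|q s] ps; first by rewrite big_nil mulr1 => e; rewrite e uu in pU.
rewrite big_cons mulrCA; move: (u * _) => v e.
have [q0 qU qd] : prime_elt q by apply: ps; rewrite inE eqxx.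
have vu : v \is a GRing.unit.
  by case: (irr _ _ e) => // qu; rewrite qu in qU.
split=> // a b [c ab]; have : divides q (a * b).
  by exists (v * c); rewrite ab e mulrA.
have H d : divides p (q * d) by exists (v^-1 * d); rewrite e -mulrA mulVKr.
by case/qd => -[d ->]; [left|right]; apply: H.
Qed.

(** A nonunit of a factorial domain has a prime factor. *)
Lemma prime_factor_ex p : factorial_dom -> p != 0 -> p \isn't a GRing.unit ->
  exists q v, prime_elt q /\ p = q * v.
Proof.
move=> fA p0 pU; have [s [ps [u uu e]]] := fA p p0.
case: s ps e => [|q s] ps; first by rewrite big_nil mulr1 => e; rewrite e uu in pU.
rewrite big_cons mulrCA => e; exists q; exists (u * \prod_(p <- s) p); split=> //.
by apply: ps; rewrite inE eqxx.
Qed.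

End Factorial.

Section FactorialPoly.
Variable A : idomainType.
Implicit Types (p q f g r : {poly A}) (a c u : A) (s t : seq A).

Lemma divides_polyC a f : divides a%:P f <-> forall i, divides a f`_i.
Proof.
split=> [[g ->] i|/choice[g fg]]; first by rewrite coefCM; exists g`_i.
exists (\poly_(i < size f) g i); apply/polyP => i.
rewrite coefCM coef_poly; case: ltnP => [_|le]; first exact: fg.
by rewrite mulr0 nth_default.
Qed.

Lemma divides_polyC_MXaddC a f c :
  divides a%:P (f * 'X + c%:P) <-> divides a%:P f /\ divides a c.
Proof.
split=> [/divides_polyC d|[d1 [b ->]]].
  split; last by have := d 0; rewrite coefD coefMX coefC eqxx add0r.
  by apply/divides_polyC => i; have := d i.+1; rewrite coefD coefMX coefC addr0.
by apply: divides_add; [exact: divides_mulr | exists b%:P; rewrite polyCM].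
Qed.

(** A prime of [A] remains prime in [A[X]]: if it divides a product, it divides
    one of the two constant terms, and that term can be dropped. *)
Lemma prime_polyC a : prime_elt a -> prime_elt a%:P.
Proof.
case=> a0 aU ad; split; first by rewrite polyC_eq0.
  by rewrite poly_unitE coefC /= (negPf aU) andbF.
elim/poly_ind=> [g _|f c IHf]; first by left; exists 0; rewrite mulr0.
elim/poly_ind=> [_|g d IHg]; first by right; exists 0; rewrite mulr0.
set F := f * _ + _; set G := g * _ + _ => dFG.
have FGE : F * G = (f * G + c%:P * g) * 'X + (c * d)%:P.
  by rewrite /F /G polyCM; ring.
have := dFG; rewrite FGE divides_polyC_MXaddC => -[d1 /ad[dc|dd]].
  case: (IHf G) => [|df|]; [|left|by right].
    have [e ce] := dc; have [h eh] := d1; exists (h - e%:P * g).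
    by rewrite mulrBr -eh mulrA -polyCM -ce; ring.
  by apply/divides_polyC_MXaddC.
case: IHg => [|df|dg]; [|by left|right; exact/divides_polyC_MXaddC].
have [e de] := dd; have : divides a%:P (F * g * 'X + 0%:P).
  have [h eh] := dFG; exists (h - e%:P * F).
  by rewrite mulrBr -eh mulrA -polyCM -de /G; ring.
by case/divides_polyC_MXaddC.
Qed.

(** Clearing a constant: when a nonzero constant multiple of [r] factors, so
    does [r], with factors of the same degrees. *)
Lemma split_polyC c r f g : has_factors c -> c != 0 -> c *: r = f * g ->
  exists f' g', [/\ r = f' * g', size f' = size f & size g' = size g].
Proof.
move=> [s [ps [u uu ->]]] _; elim: s f g ps => [|p s IH] f g ps.
  rewrite big_nil mulr1 => e; exists (u^-1 *: f), g; split=> //.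
    by rewrite -scalerAl -e scalerA mulVr // scale1r.
  by rewrite size_scale // invr_eq0; apply: contraTneq uu => ->; rewrite unitr0.
have pp : prime_elt p by apply: ps; rewrite inE eqxx.
have {}ps (b : A) : b \in s -> prime_elt b by move=> bs; apply: ps; rewrite inE bs orbT.
have [p0 _ _] := pp; have pP0 : p%:P != 0 by rewrite polyC_eq0.
rewrite big_cons mulrCA -scalerA -mul_polyC => e.
have [_ _ pd] := prime_polyC pp.
have : divides p%:P (f * g) by rewrite -e; exists (u * \prod_(q <- s) q *: r).
case/pd => -[h eh]; move: e; rewrite eh.
  rewrite -mulrA => /(mulfI pP0)/(IH _ _ ps)[f' [g' [-> sf sg]]].
  by exists f', g'; rewrite mul_polyC size_scale.
rewrite mulrCA => /(mulfI pP0)/(IH _ _ ps)[f' [g' [-> sf sg]]].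
by exists f', g'; rewrite mul_polyC size_scale.
Qed.

(** Primitive polynomials: no prime constant divides all the coefficients. *)
Definition primitive f := forall a, prime_elt a -> ~ divides a%:P f.

(** Gauss's lemma: a primitive polynomial that is not a product of two
    nonconstant polynomials is prime.  Pseudo-division over the domain [A] does
    duty for division over its field of fractions: there [p] is irreducible
    ([irreducible_poly]), and a pseudo-divisibility [p %| q], that is
    [c *: q = r * p] with [c] nonzero, becomes a true one by cancelling the
    primes of [c] from [r]. *)
Lemma prime_primitive p : factorial_dom A -> (1 < size p)%N -> primitive p ->
  (forall f g, p = f * g -> (size f <= 1)%N \/ (size g <= 1)%N) -> prime_elt p.
Proof.
move=> fA sp prim irr.
have p0 : p != 0 by rewrite -size_poly_gt0 ltnW.
have irrp : irreducible_poly p.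
  split=> // q sq /Pdiv.Idomain.dvdpP [[c r] /= c0 e].
  have [r' [q' [pe sr' sq']]] := split_polyC (fA _ c0) c0 e.
  have q'0 : q' != 0 by apply: contraNneq p0 => q0; rewrite pe q0 mulr0.
  have r'0 : r' != 0 by apply: contraNneq p0 => r0; rewrite pe r0 mul0r.
  have sr1 : size r' = 1%N.
    apply/eqP; rewrite eqn_leq size_poly_gt0 r'0 andbT.
    case: (irr _ _ pe) => //; rewrite sq' => sq1.
    move: sq; rewrite neq_ltn ltnS leqn0 size_poly_eq0 -size_poly_eq0 -sq'.
    by rewrite size_poly_eq0 (negPf q'0) sq' ltnNge sq1.
  have: q %| p by apply/Pdiv.Idomain.dvdpP; exists (c, r).
  move/dvdp_size_eqp => <-; rewrite pe size_mul // sr1 add1n /= sq'.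
  by rewrite eqxx.
have pU : p \isn't a GRing.unit by rewrite poly_unitE (gtn_eqF sp).
split=> // f g [h fg].
have key q : p %| q -> divides p q.
  case/Pdiv.Idomain.dvdpP => [[c r] /= c0].
  have [s [ps [u uu ce]]] := fA _ c0; rewrite {}ce {c c0}.
  elim: s r ps => [|a s IH] r ps.
    rewrite big_nil mulr1 => e; exists (u^-1 *: r).
    by rewrite -scalerAr mulrC -e scalerA mulVr // scale1r.
  have pa : prime_elt a by apply: ps; rewrite inE eqxx.
  have {}ps (b : A) : b \in s -> prime_elt b by move=> bs; apply: ps; rewrite inE bs orbT.
  rewrite big_cons mulrCA -scalerA -mul_polyC => e.
  have [aP0 _ ad] := prime_polyC pa.
  have : divides a%:P (r * p) by rewrite -e; exists (u * \prod_(q <- s) q *: q).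
  case/ad => [[r' er]|/(prim _ pa) //].
  by move: e; rewrite er -mulrA => /(mulfI aP0); apply: IH.
have pfg : p %| f * g by rewrite fg dvdp_mulr.
case: (irredp_XsubCP irrp (dvdp_gcdl p f)) => [cop|].
  right; apply: key; rewrite -(@Gauss_dvdpr _ g f p) //.
  by rewrite /coprimep size_poly_eq1.
by move=> /eqp_dvdl e; left; apply: key; rewrite -e dvdp_gcdr.
Qed.

(** A nonzero polynomial is a product of prime constants and a primitive
    polynomial.  Stripping a prime off removes one prime factor from the leading
    coefficient, so the process ends. *)
Lemma primitive_part f : factorial_dom A -> f != 0 ->
  exists c g, [/\ f = c%:P * g, has_factors c%:P, primitive g & size g = size f].
Proof.
move=> fA f0; have := f0; rewrite -lead_coef_eq0 => /fA[s [ps [u uu]]].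
have [n] := ubnP (size s); elim: n => // n IH in f f0 s ps u uu *.
rewrite ltnS => sn e.
have [|] := pselect (primitive f).
  exists 1, f; split=> //; first by rewrite mul1r.
  by apply: has_factors_unit; rewrite unitr1.
move/existsNP => [a /not_implyP[pa /contrapT[g fg]]].
have [a0 _ _] := pa.
have g0 : g != 0 by apply: contraNneq f0; rewrite fg => ->; rewrite mulr0.
have la : lead_coef f = a * lead_coef g by rewrite fg lead_coefM lead_coefC.
have : divides a (u * \prod_(q <- s) q) by rewrite -e la; exists (lead_coef g).
case/(prime_divides_prod pa ps uu) => s' [v [ss' ps' uv]].
rewrite -e la => /(mulfI a0) e'.
have [c [h [gh fc ph sh]]] := IH _ g0 s' ps' v uv (leq_trans ss' sn) e'.
exists (a * c), h; split=> //.
- by rewrite fg gh mulrA polyCM.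
- rewrite polyCM; apply: has_factorsM fc.
  exact/has_factors_prime/prime_polyC.
- by rewrite sh fg mul_polyC size_scale.
Qed.

Lemma factorial_poly : factorial_dom A -> factorial_dom {poly A}.
Proof.
move=> fA f; have [n] := ubnP (size f); elim: n f => // n IH f.
rewrite ltnS => sn f0.
have [c [g [fE fc pg sg]]] := primitive_part fA f0.
have g0 : g != 0 by rewrite -size_poly_gt0 sg size_poly_gt0.
rewrite fE; apply: has_factorsM fc _.
have [g1|g1] := leqP (size g) 1.
  have gE := size1_polyC g1.
  have : g`_0 != 0 by rewrite -polyC_eq0 -gE.
  case/fA => s [ps [u uu e]]; exists (map polyC s); split.
    by move=> _ /mapP[p /ps pp ->]; apply: prime_polyC.
  exists u%:P.
    have u0 : u != 0 by apply: contraTneq uu => ->; rewrite unitr0.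
    by rewrite poly_unitE size_polyC coefC u0 uu.
  by rewrite gE e polyCM rmorph_prod big_map.
have [irr|] := pselect (forall p q, g = p * q -> (size p <= 1)%N \/ (size q <= 1)%N).
  exact/has_factors_prime/prime_primitive.
move/existsNP => [p /existsNP[q /not_implyP[ge /not_orP[/negP p1 /negP q1]]]].
rewrite -!ltnNge in p1 q1.
have p0 : p != 0 by rewrite -size_poly_gt0 ltnW.
have q0 : q != 0 by rewrite -size_poly_gt0 ltnW.
have := sg; rewrite ge size_mul // => sf.
apply: has_factorsM; apply: IH => //; apply: leq_trans sn; rewrite -sf.
  by case: (size q) q1 => [|[|k]] // _; rewrite !addnS /= ltnS leq_addr.
by case: (size p) p1 => [|[|k]] // _; rewrite !addSn /= ltnS leq_addl.
Qed.

End FactorialPoly.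

(** * Polynomials in several variables form a factorial domain *)

Section Transport.
Variables (A B : idomainType) (phi : {rmorphism A -> B}) (psi : B -> A).
Hypotheses (phiK : cancel phi psi) (psiK : cancel psi phi).

Let divides_phi a b : divides (phi a) (phi b) -> divides a b.
Proof.
case=> c e; exists (psi c); apply: (can_inj phiK).
by rewrite rmorphM /= psiK.
Qed.

Let unit_phi a : phi a \is a GRing.unit -> a \is a GRing.unit.
Proof.
move=> u; apply/unitrP; exists (psi (phi a)^-1).
by split; apply: (can_inj phiK); rewrite rmorphM rmorph1 /= psiK ?mulVr ?mulrV.
Qed.

Lemma prime_iso a : prime_elt (phi a) -> prime_elt a.
Proof.
case=> a0 aU ad; split.
- by apply: contraNneq a0 => ->; rewrite rmorph0.
- by apply: contraNN aU => /(rmorph_unit phi).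
move=> b c [d e]; have : divides (phi a) (phi b * phi c).
  by exists (phi d); rewrite -!rmorphM e.
by case/ad => /divides_phi; [left|right].
Qed.

Lemma factorial_iso : factorial_dom B -> factorial_dom A.
Proof.
move=> fB a a0; have : phi a != 0 by rewrite -(rmorph0 phi) (inj_eq (can_inj phiK)).
case/fB => s [ps [u uu e]]; exists (map psi s); split.
  by move=> _ /mapP[p /ps pp ->]; apply: prime_iso; rewrite psiK.
exists (psi u); first by apply: unit_phi; rewrite psiK.
apply: (can_inj phiK); rewrite e rmorphM rmorph_prod /= psiK big_map.
by congr (_ * _); apply: eq_bigr => p _; rewrite psiK.
Qed.

End Transport.

Section MpolyFactorial.
Variable F : fieldType.

(** The inverse of [muni], which reads a polynomial in [n.+1] variables as a
    polynomial in the last one. *)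
Definition unmuni n (q : {poly {mpoly F[n]}}) : {mpoly F[n.+1]} :=
  (map_poly (@mwiden n F) q).['X_ord_max].

HB.instance Definition _ n := GRing.RMorphism.copy (@unmuni n)
  (horner_eval ('X_ord_max : {mpoly F[n.+1]}) \o map_poly (@mwiden n F)).

Lemma muniX n (m : 'X_{1..n.+1}) : muni ('X_[m] : {mpoly F[n.+1]}) =
  'X_[[multinom m (widen_ord (leqnSn n) i) | i < n]] *: 'X^(m ord_max).
Proof. by rewrite muniE msuppX big_seq1 mcoeffX eqxx scale1r. Qed.

Lemma muniK n : cancel (@muni n F) (@unmuni n).
Proof.
move=> p; elim/mpolyind: p => [|c m p _ _ IH]; first by rewrite !rmorph0.
rewrite !rmorphD /=; congr (_ + _); last exact: IH.
rewrite -mul_mpolyC !rmorphM /=; congr (_ * _).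
  by rewrite muniC /unmuni map_polyC hornerC /= mwidenC.
rewrite muniX /unmuni linearZ /= map_polyXn hornerZ hornerXn mwidenX.
rewrite mpolyXn -mpolyXD; congr 'X_[_]; apply/mnmP => i.
rewrite mnmDE mulmnE mnm1E; case: (unliftP ord_max i) => [j|] ->.
  have -> : fintype.lift ord_max j = widen_ord (leqnSn n) j.
    by apply/val_inj; exact: lift_max.
  rewrite mnmwiden_widen mnmE.
  have -> : (ord_max == widen_ord (leqnSn n) j) = false.
    by apply/eqP => /(congr1 val) /= e; have := ltn_ord j; rewrite -e ltnn.
  by rewrite addn0.
by rewrite mnmwiden_ordmax add0n eqxx mul1n.
Qed.

Lemma unmuniK n : cancel (@unmuni n) (@muni n F).
Proof.
elim/poly_ind => [|q c IH]; first by rewrite !rmorph0.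
rewrite !rmorphD !rmorphM /= IH; congr (_ * _ + _).
  rewrite /unmuni map_polyX hornerX muniX [X in 'X_[X]](_ : _ = 0%MM).
    by rewrite mpolyX0 scale1r mnm1E eqxx expr1.
  apply/mnmP => i; rewrite mnmE mnm0E mnm1E.
  by case: eqP => // /(congr1 val) /= e; have := ltn_ord i; rewrite -e ltnn.
rewrite /unmuni map_polyC hornerC /=.
elim/mpolyind: c => [|a m p _ _ {}IH]; first by rewrite !rmorph0.
rewrite !rmorphD /=; congr (_ + _); last exact: IH.
rewrite -mul_mpolyC !rmorphM /= mwidenC muniC; congr (_ * _).
rewrite mwidenX muniX mnmwiden_ordmax expr0 alg_polyC; congr ('X_[_])%:P.
by apply/mnmP => i; rewrite mnmE mnmwiden_widen.
Qed.

Lemma factorial_mpoly n : factorial_dom {mpoly F[n]}.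
Proof.
elim: n => [|n IH]; last first.
  exact: (factorial_iso (@muniK n) (@unmuniK n) (factorial_poly IH)).
move=> p; rewrite -[p]mpolyKC => p0; apply: has_factors_unit.
by apply: rmorph_unit; rewrite unitfE; apply: contraNneq p0 => ->.
Qed.

End MpolyFactorial.

(** * Homogeneous factors and prime divisors of the plane *)

Section HomogFactor.
Variables (F : fieldType) (n : nat).
Implicit Types p q r : {mpoly F[n]}.

(** The homomorphism [x_i |-> x_i t] into polynomials in [t]; its coefficients
    are the homogeneous components. *)
Definition grading : {mpoly F[n]} -> {poly {mpoly F[n]}} :=
  mmap (polyC \o @mpolyC n F) (fun i => 'X_i *: 'X).

HB.instance Definition _ := GRing.RMorphism.copy grading
  (mmap (polyC \o @mpolyC n F) (fun i => 'X_i *: 'X : {poly {mpoly F[n]}})).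

Lemma coef_grading p k : (grading p)`_k = pihomog mdeg k p.
Proof.
rewrite /grading /mmap pihomogE coef_sum [RHS]big_mkcond /=.
apply: eq_bigr => m _; rewrite coefCM.
have -> : mmap1 (fun i => 'X_i *: 'X) m = 'X_[m] *: 'X^(mdeg m) :> {poly {mpoly F[n]}}.
  rewrite /mmap1 mdegE -prodrXr mpolyXE_id -mul_polyC rmorph_prod -big_split /=.
  by apply: eq_bigr => i _; rewrite exprZn -mul_polyC rmorphXn.
rewrite coefZ coefXn eq_sym; case: eqP => _; rewrite ?mulr1 ?mulr0 //.
by rewrite mul_mpolyC.
Qed.

(** The factors of a nonzero form are forms: their images under [grading] divide
    a power of [t] up to a scalar, hence are monomials in [t]. *)
Lemma homog_factor q r d : q * r != 0 -> q * r \is d.-homog ->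
  exists k, q \is k.-homog.
Proof.
move=> qr0 hqr.
have e : grading q * grading r = (q * r) *: 'X^d.
  rewrite -rmorphM; apply/polyP => k; rewrite coef_grading coefZ coefXn.
  have [->|kd] := eqVneq k d; first by rewrite pihomog_dE // mulr1.
  by rewrite (pihomog_ne0 _ hqr) ?mulr0 // eq_sym.
have : grading q %| ('X - 0%:P) ^+ d.
  apply/Pdiv.Idomain.dvdpP; exists (q * r, grading r) => //=.
  by rewrite subr0 -e; exact: mulrC.
case/dvdp_exp_XsubCP => k _; rewrite subr0 => /eqpP[[c1 c2] /= /andP[c10 c20] e'].
exists k; have H j : j != k -> pihomog mdeg j q = 0.
  move=> jk; move/(congr1 (fun f : {poly _} => f`_j)): e'.
  rewrite !coefZ coefXn (negPf jk) mulr0 coef_grading => /eqP.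
  by rewrite mulf_eq0 (negPf c10) => /eqP.
rewrite (pihomog_partitionE (leqnn (mmeasure mdeg q))); apply: rpred_sum => j _.
have [->|/H->] := eqVneq (j : nat) k; first exact: pihomogP.
exact: rpred0.
Qed.

End HomogFactor.

Section PrimeDivisors.
Variable C : numClosedFieldType.
Implicit Types (p q r : hpoly C) (P Q : prime_divisor C).

Lemma prime_irreducible p : prime_elt p -> mirreducible p.
Proof.
by move=> pp; have [p0 pU _] := pp; split=> // q r; apply: prime_factor.
Qed.

Lemma irreducible_prime p : mirreducible p -> prime_elt p.
Proof.
by move=> [p0 pU irr]; apply: irreducible_is_prime => //; apply: factorial_mpoly.
Qed.

Lemma mpoly_unit_const p : p \is a GRing.unit -> exists2 c : C, c != 0 & p = c%:MP.
Proof.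
by move=> /andP[/eqP e u]; exists p@_0%MM => //; rewrite -unitfE.
Qed.

Lemma const_unit (c : C) : c != 0 -> (c%:MP : hpoly C) \is a GRing.unit.
Proof. by move=> c0; apply: rmorph_unit; rewrite unitfE. Qed.

Lemma irreducibleZ (c : C) p : c != 0 -> mirreducible p -> mirreducible (c *: p).
Proof.
move=> c0 [p0 pU irr]; have cU := const_unit c0.
rewrite -mul_mpolyC; split.
- by rewrite mulf_neq0 // mpolyC_eq0.
- by rewrite unitrM cU.
move=> q r e; have : p = ((c^-1)%:MP * q) * r.
  by rewrite -mulrA -e mulrA -mpolyCM mulVf // mpolyC1 mul1r.
by case/irr; [rewrite unitrM => /andP[_]; left|right].
Qed.

(** An irreducible form, made monic, defines a prime divisor. *)
Lemma prime_divisor_ex p d : mirreducible p -> p \is d.-homog ->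
  exists P : prime_divisor C, equation P = (mleadc p)^-1 *: p.
Proof.
move=> ip hp; have [p0 _ _] := ip.
have c0 : (mleadc p)^-1 != 0 by rewrite invr_eq0 mleadc_eq0.
suff h : is_prime_eq ((mleadc p)^-1 *: p) by exists (PrimeDivisor h).
apply/asboolP; split; first exact: irreducibleZ.
  by exists d; apply: dhomogZ.
by rewrite mleadZ // mcoeffZ mulVf // mleadc_eq0.
Qed.

Lemma equation_irr P : mirreducible (equation P).
Proof. by case: P => p /= /asboolP[]. Qed.

Lemma equation_prime P : prime_elt (equation P).
Proof. exact/irreducible_prime/equation_irr. Qed.

Lemma equation_homog P : exists d, equation P \is d.-homog.
Proof. by case: P => p /= /asboolP[]. Qed.

Lemma equation_leadc P : mleadc (equation P) = 1.
Proof. by case: P => p /= /asboolP[]. Qed.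

Lemma equation_neq0 P : equation P != 0.
Proof. by case: (equation_irr P). Qed.

Lemma homog_prime_factor p d : p != 0 -> p \isn't a GRing.unit -> p \is d.-homog ->
  exists P, mdivides P p.
Proof.
move=> p0 pU hp.
have [q [v [pq e]]] := prime_factor_ex (@factorial_mpoly C 3) p0 pU.
rewrite e in p0 hp; have [k hq] := homog_factor p0 hp.
have [P eP] := prime_divisor_ex (prime_irreducible pq) hq.
have [q0 _ _] := pq; have c0 : mleadc q != 0 by rewrite mleadc_eq0.
exists P; exists (mleadc q *: v).
by rewrite eP e -scalerAl -scalerAr scalerA mulVf // scale1r.
Qed.

(** Two prime divisors, one of which divides the other, are equal. *)
Lemma mdivides_eq P Q : mdivides P Q -> P = Q.
Proof.
move=> [r e]; have [_ _ irr] := equation_irr Q; have [_ PU _] := equation_irr P.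
case: (irr _ _ e) => [PU'|/mpoly_unit_const[c c0 rc]]; first by rewrite PU' in PU.
apply: val_inj; rewrite /=; have := equation_leadc Q.
rewrite e rc mulrC mul_mpolyC mleadZ // mcoeffZ equation_leadc mulr1 => ->.
by rewrite scale1r.
Qed.

End PrimeDivisors.

(** * Orders of rational functions along curves *)

Lemma cross_mul (F : fieldType) (u v w x y : F) : v != 0 -> y != 0 ->
  u / v = w * (x / y) -> u * y = w * x * v.
Proof. by move=> v0 y0 /(canRL (divfK v0)) ->; field. Qed.

Section Orders.
Variable C : numClosedFieldType.
Implicit Types (p q r a b : hpoly C) (P Q : prime_divisor C) (f g : hfrac C).

Lemma equationF_neq0 P : (equation P)%:F != 0.
Proof. by rewrite tofrac_eq0 equation_neq0. Qed.

Lemma mdividesM P a b : mdivides P (a * b) -> mdivides P a \/ mdivides P b.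
Proof. by have [_ _] := equation_prime P; apply. Qed.

Lemma not_mdivides1 P : ~ mdivides P 1.
Proof.
have [_ PU _] := equation_prime P.
by move=> /(divides_unit (unitr1 _)) PU'; rewrite PU' in PU.
Qed.

Lemma has_order1 P : has_order P 1 0.
Proof.
exists 1, 1; split; [exact: not_mdivides1|exact: not_mdivides1|].
by rewrite expr0z mul1r divff // tofrac_eq0 oner_eq0.
Qed.

Lemma has_orderM P f g m n :
  has_order P f m -> has_order P g n -> has_order P (f * g) (m + n).
Proof.
move=> [a [b [Pa Pb ->]]] [a' [b' [Pa' Pb' ->]]].
exists (a * a'), (b * b'); split; [by case/mdividesM|by case/mdividesM|].
by rewrite expfzDr ?equationF_neq0 // !tofracM invfM; ring.
Qed.

Lemma has_orderV P f n : has_order P f n -> has_order P f^-1 (- n).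
Proof.
move=> [a [b [Pa Pb ->]]]; exists b, a; split=> //.
by rewrite invfM invf_div invr_expz.
Qed.

Lemma has_orderN P f n : has_order P f n -> has_order P (- f) n.
Proof.
move=> [a [b [Pa Pb ->]]]; exists (- a), b; split=> //.
  by case=> r ar; apply: Pa; exists (- r); rewrite mulrN -ar opprK.
by rewrite tofracN mulNr mulrN.
Qed.

Lemma has_orderX P f n k : has_order P f n -> has_order P (f ^+ k) (n *+ k).
Proof.
move=> fn; elim: k => [|k IH]; first exact: has_order1.
by rewrite exprS mulrS; apply: has_orderM.
Qed.

Lemma has_order_equation P Q : has_order P (equation Q)%:F (Q == P)%:R.
Proof.
have [->|QP] := eqVneq Q P.
  exists 1, 1; split; [exact: not_mdivides1|exact: not_mdivides1|].
  by rewrite expr1z divff ?mulr1 // tofrac_eq0 oner_eq0.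
exists (equation Q), 1; split; [|exact: not_mdivides1|].
  by move/mdivides_eq=> PQ; rewrite PQ eqxx in QP.
by rewrite expr0z mul1r tofrac1 divr1.
Qed.

Lemma has_order_coord P i :
  has_order P ('X_i : hpoly C)%:F (coord_line C i == P)%:R.
Proof. exact: (has_order_equation P (coord_line C i)). Qed.

Lemma has_order_poly P a : a != 0 -> exists n : nat, has_order P a%:F n.
Proof.
have [k] := ubnP (msize a); elim: k a => // k IH a; rewrite ltnS => ak a0.
have [[b ab]|Pa] := pselect (mdivides P a); last first.
  exists 0%N, a, 1; split=> //; first exact: not_mdivides1.
  by rewrite expr0z mul1r tofrac1 divr1.
have b0 : b != 0 by apply: contraNneq a0 => b0; rewrite ab b0 mulr0.
have P1 : (1 < msize (equation P))%N.
  have [P0 PU _] := equation_irr P.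
  rewrite ltnNge; apply/negP => P1; case/negP: PU.
  have := P1; rewrite leq_eqVlt ltnS leqn0 msize_poly_eq0 (negPf P0) orbF.
  by move/msize_poly1P => [c c0 ->]; apply: const_unit.
have [n bn] : exists n : nat, has_order P b%:F n.
  apply: IH (b0); apply: leq_trans ak; rewrite ab msizeM ?equation_neq0 //.
  by case: (msize (equation P)) P1 => [|[|j]] // _; rewrite !addSn /= ltnS leq_addl.
exists n.+1; rewrite ab tofracM intS; apply: has_orderM => //.
by have := has_order_equation P P; rewrite eqxx.
Qed.

Lemma is_ratfunM f g : is_ratfun f -> is_ratfun g -> is_ratfun (f * g).
Proof.
move=> [d [a [b [ha hb b0 ->]]]] [d' [a' [b' [ha' hb' b'0 ->]]]].
exists (d + d')%N, (a * a'), (b * b').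
split; [exact: dhomogM|exact: dhomogM|exact: mulf_neq0|].
by rewrite !tofracM invfM; ring.
Qed.

Lemma is_ratfunV f : is_ratfun f -> is_ratfun f^-1.
Proof.
move=> [d [a [b [ha hb b0 ->]]]]; rewrite invf_div.
have [->|a0] := eqVneq a 0; last by exists d, b, a.
exists 0%N, 0, 1; split; rewrite ?oner_eq0 ?tofrac0 ?invr0 ?mulr0 ?mul0r //.
  exact: dhomog0.
exact: dhomog1.
Qed.

Lemma is_ratfunN f : is_ratfun f -> is_ratfun (- f).
Proof.
move=> [d [a [b [ha hb b0 ->]]]]; exists d, (- a), b; split=> //.
  by rewrite dhomogN.
by rewrite tofracN mulNr.
Qed.

Lemma is_ratfun1 : is_ratfun (1 : hfrac C).
Proof.
exists 0%N, 1, 1; split; rewrite ?oner_eq0 ?tofrac1 ?divr1 //; exact: dhomog1.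
Qed.

Lemma is_ratfunX f k : is_ratfun f -> is_ratfun (f ^+ k).
Proof.
move=> hf; elim: k => [|k IH]; first exact: is_ratfun1.
by rewrite exprS; apply: is_ratfunM.
Qed.

Lemma homog_const p : p \is 0.-homog -> exists c : C, p = c%:MP.
Proof.
move=> h; exists p@_0%MM; apply/mpolyP => m; rewrite mcoeffC.
have [->|m0] := eqVneq m 0%MM; first by rewrite mulr1.
by rewrite mulr0 (dhomog_nemf_coeff h) // mdeg_eq0.
Qed.

Lemma homog_cofactor P q e d : equation P \is e.-homog -> q != 0 ->
  equation P * q \is d.-homog -> exists2 k, q \is k.-homog & d = (e + k)%N.
Proof.
move=> hP q0 h; have PQ0 := mulf_neq0 (equation_neq0 P) q0.
have [k hk] : exists k, q \is k.-homog.
  by apply: (@homog_factor _ _ q (equation P) d); rewrite mulrC.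
by exists k => //; apply: dhomog_uniq PQ0 h _; apply: dhomogM.
Qed.

(** A rational function without poles is constant: a curve dividing the
    denominator also divides the numerator, and can be cancelled from both. *)
Lemma no_poles_const f : is_ratfun f ->
  (forall P, exists n : nat, has_order P f n) -> exists c : C, f = (c%:MP)%:F.
Proof.
move=> [d [a [b [ha hb b0 ->]]]].
have [k] := ubnP d; elim: k d a b ha hb b0 => // k IH d a b ha hb b0.
rewrite ltnS => dk ord.
have [/mpoly_unit_const[c c0 bc]|bU] := boolP (b \is a GRing.unit).
  have d0 : d = 0%N.
    apply: (dhomog_uniq b0 hb).
    by rewrite bc -[c%:MP]mulr1 mul_mpolyC dhomogZ ?dhomog1.
  rewrite d0 in ha; have [c' ac] := homog_const ha.
  exists (c' / c); rewrite ac bc mpolyCM tofracM; congr (_ * _).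
  apply: (mulfI (x := (c%:MP)%:F)); first by rewrite tofrac_eq0 mpolyC_eq0.
  rewrite divff ?tofrac_eq0 ?mpolyC_eq0 // -tofracM -mpolyCM divff //.
have [P [b' bE]] := homog_prime_factor b0 bU hb.
have b'0 : b' != 0 by apply: contraNneq b0 => b'0; rewrite bE b'0 mulr0.
have [e hP] := equation_homog P.
have e0 : (0 < e)%N.
  rewrite lt0n; apply/eqP => e0; rewrite e0 in hP.
  have [c Pc] := homog_const hP; have [P0 PU _] := equation_irr P.
  move: P0 PU; rewrite Pc mpolyC_eq0 => c0; by rewrite const_unit.
have hb' := hb; rewrite bE in hb'; have {hb'}[j hb' dE] := homog_cofactor hP b'0 hb'.
have [n [a1 [b1 [Pa1 Pb1 E]]]] := ord P.
have b10 : b1 != 0 by apply/eqP => b10; apply: Pb1; exists 0; rewrite b10 mulr0.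
have : mdivides P (a * b1).
  exists (equation P ^+ n * a1 * b').
  have -> : equation P * (equation P ^+ n * a1 * b') = equation P ^+ n * a1 * b :> hpoly C.
    by rewrite bE; ring.
  have bF0 : b%:F != 0 by rewrite tofrac_eq0.
  have b1F0 : b1%:F != 0 by rewrite tofrac_eq0.
  apply/eqP; rewrite -tofrac_eq; apply/eqP; rewrite !tofracM tofracXn.
  exact: cross_mul bF0 b1F0 E.
case/mdividesM => // -[a' aE].
have E' : a%:F / b%:F = a'%:F / b'%:F.
  by rewrite aE bE !tofracM -mulf_div divff ?mul1r ?equationF_neq0.
rewrite E' in ord *.
have [a'0|a'0] := eqVneq a' 0.
  by exists 0; rewrite a'0 mpolyC0 tofrac0 mul0r.
rewrite aE in ha; have [j' ha' dE'] := homog_cofactor hP a'0 ha.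
have jj : j' = j by apply/eqP; rewrite -(eqn_add2l e) -dE -dE'.
rewrite jj in ha'; apply: (IH j a' b') => //.
by apply: leq_trans dk; rewrite dE -[X in (X < _)%N]add0n ltn_add2r.
Qed.

End Orders.

(** * The chart forms and the canonical divisor *)

Lemma ord3P (i : 'I_3) : [\/ i = 0, i = 1 | i = 2%:R].
Proof.
case: i => [[|[|[|i]]] //= hi]; [constructor 1|constructor 2|constructor 3].
all: exact: val_inj.
Qed.

(** The coefficient of [dx_l] in [d(x_m / x_i)], for values of the [x_i] in an
    arbitrary field. *)
Definition dchart (K : fieldType) (X : 'I_3 -> K) (i m l : 'I_3) : K :=
  ((X i) *+ (m == l) - (X m) *+ (i == l)) / (X i) ^+ 2.

(** The entries of [chart_form_glue], checked one by one. *)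
Lemma dchart_glue (K : fieldType) (X : 'I_3 -> K) (i j k : 'I_3) :
  (forall l, X l != 0) ->
  let a (i : 'I_3) := fintype.lift i (0 : 'I_2) in
  let b (i : 'I_3) := fintype.lift i (1 : 'I_2) in
  let e i := dchart X i (a i) j * dchart X i (b i) k
             - dchart X i (b i) j * dchart X i (a i) k in
  (-1) ^+ i * X i ^+ 3 * e i = X 0 ^+ 3 * e 0.
Proof.
move=> X0 /=; rewrite /dchart.
have l00 : fintype.lift (0 : 'I_3) (0 : 'I_2) = 1 by apply: val_inj.
have l01 : fintype.lift (0 : 'I_3) (1 : 'I_2) = 2%:R by apply: val_inj.
have l10 : fintype.lift (1 : 'I_3) (0 : 'I_2) = 0 by apply: val_inj.
have l11 : fintype.lift (1 : 'I_3) (1 : 'I_2) = 2%:R by apply: val_inj.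
have l20 : fintype.lift (2%:R : 'I_3) (0 : 'I_2) = 0 by apply: val_inj.
have l21 : fintype.lift (2%:R : 'I_3) (1 : 'I_2) = 1 by apply: val_inj.
have s1 : (-1) ^+ (1%R : 'I_3) = -1 :> K by rewrite expr1.
have s2 : (-1) ^+ (2%:R%R : 'I_3) = 1 :> K by rewrite sqrrN expr1n.
have n01 : (0 == 1 :> 'I_3) = false by [].
have n02 : (0 == 2%:R :> 'I_3) = false by [].
have n12 : (1 == 2%:R :> 'I_3) = false by [].
have n10 : (1 == 0 :> 'I_3) = false by [].
have n20 : (2%:R == 0 :> 'I_3) = false by [].
have n21 : (2%:R == 1 :> 'I_3) = false by [].
move: (X0 0) (X0 1) (X0 2%:R).
case: (ord3P i) => ->; rewrite l00 l01 ?l10 ?l11 ?l20 ?l21 ?expr0 ?s1 ?s2.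
all: move: (X 0) (X 1) (X 2%:R) => x0 x1 x2 h0 h1 h2.
all: case: (ord3P j) => ->; case: (ord3P k) => ->;
  rewrite ?eqxx ?n01 ?n02 ?n12 ?n10 ?n20 ?n21 ?mulr1n ?mulr0n.
all: field; by rewrite ?h0 ?h1 ?h2.
Qed.

Section Canonical.
Variable C : numClosedFieldType.
Implicit Types (P Q : prime_divisor C) (f g : hfrac C).

Lemma mderivXU (i j : 'I_3) : ('X_j : hpoly C)^`M(i) = (j == i)%:R.
Proof.
rewrite mderivX mnm1E; case: eqP => [->|_]; last by rewrite scale0r.
rewrite scale1r [X in 'X_[X]](_ : _ = 0%MM) ?mpolyX0 //.
by apply/mnmP => k; rewrite mnmBE subnn mnm0E.
Qed.

Local Notation x i := (('X_i : hpoly C)%:F : hfrac C).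

Lemma coordF_neq0 i : x i != 0.
Proof. exact: (equationF_neq0 (coord_line C i)). Qed.

Lemma dquotX (i j l : 'I_3) :
  dquot ('X_j : hpoly C) 'X_i 0 l = dchart (fun i => x i) i j l.
Proof.
rewrite /dchart mxE !mderivXU tofracXn; congr (_ / _).
by rewrite tofracB !mulr_natr !tofracMn.
Qed.

Lemma chart_formE (i j k : 'I_3) :
  let a := fintype.lift i (0 : 'I_2) in let b := fintype.lift i (1 : 'I_2) in
  let d := dchart (fun i => x i) i in
  chart_form C i j k = d a j * d b k - d b j * d a k.
Proof.
move=> a b d; rewrite /chart_form /wedge -/a -/b mxE [in X in _ + X]mxE.
rewrite ![(_ *m _) _ _]mxE !big_ord1 ![_^T _ _]mxE.
by rewrite !dquotX.
Qed.

(** On the cone, each chart form is the Euler form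
    [x_0 dx_1 dx_2 - x_1 dx_0 dx_2 + x_2 dx_0 dx_1] divided by [x_i ^ 3], up to
    sign. *)
Lemma chart_form_glue (i : 'I_3) :
  ((-1) ^+ i * x i ^+ 3) *: chart_form C i = (x 0 ^+ 3) *: chart_form C 0.
Proof.
apply/matrixP => j k; rewrite [LHS]mxE [RHS]mxE !chart_formE.
exact: (dchart_glue i j k coordF_neq0).
Qed.

End Canonical.

(** * The coordinate triangle is anticanonical *)

(** The comparison of [h0 y1 y2 / y0^2] and [h1 y0 y2 / y1^2] when
    [h0 *: chart_form 0 = h1 *: chart_form 1], on one entry of the forms. *)
Lemma log_form_glue (K : fieldType) (h0 h1 c0 c1 y0 y1 y2 : K) :
  c0 != 0 -> h0 * c0 = h1 * c1 -> y0 != 0 -> y1 != 0 ->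
  -1 * y1 ^+ 3 * c1 = y0 ^+ 3 * c0 ->
  h0 * (y1 / y0 * (y2 / y0)) = - (h1 * (y0 / y1 * (y2 / y1))).
Proof.
move=> c00 e y00 y10 g.
have c1E : c1 = - (y0 ^+ 3 / y1 ^+ 3) * c0.
  apply: (mulfI (x := -1 * y1 ^+ 3)); last by rewrite g; field.
  by rewrite mulN1r oppr_eq0 expf_neq0.
have -> : h0 = h1 * - (y0 ^+ 3 / y1 ^+ 3).
  by apply: (mulIf c00); rewrite e c1E mulrA.
by field; rewrite y00 y10.
Qed.

Section Boundary.
Variable C : numClosedFieldType.
Implicit Types (P Q : prime_divisor C) (f g : hfrac C) (D E K : divisor C).

Local Notation x i := (('X_i : hpoly C)%:F : hfrac C).

(** The sum of the three coordinate lines. *)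
Definition triangle : divisor C :=
  coord_divisor C 0 + coord_divisor C 1 + coord_divisor C 2%:R.

Lemma coeff_coord_divisor P i : coeff P (coord_divisor C i) = (coord_line C i == P)%:R.
Proof. by rewrite coeffU mul1r. Qed.

Lemma coeff_triangle P : coeff P triangle =
  (coord_line C 0 == P)%:R + (coord_line C 1 == P)%:R + (coord_line C 2%:R == P)%:R.
Proof. by rewrite !coeffD !coeff_coord_divisor. Qed.

Lemma coord_line_inj : injective (coord_line C).
Proof.
move=> i j /(congr1 (@equation C)) /= /(congr1 (mcoeff U_(j))).
rewrite !mcoeffXU eqxx; case: eqP => // _ /eqP.
by rewrite eq_sym oner_eq0.
Qed.

Lemma is_ratfun_coord i j : is_ratfun (x i / x j).
Proof.
exists 1%N, 'X_i, 'X_j; split; rewrite ?dhomogX /= ?mdeg1 //.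
by rewrite -(tofrac_eq0 ('X_j : hpoly C)) coordF_neq0.
Qed.

Lemma chart_form0_neq0 : chart_form C 0 1 2%:R != 0.
Proof.
have l00 : fintype.lift (0 : 'I_3) (0 : 'I_2) = 1 by apply: val_inj.
have l01 : fintype.lift (0 : 'I_3) (1 : 'I_2) = 2%:R by apply: val_inj.
rewrite chart_formE l00 l01 /dchart /= !mulr1n !mulr0n !subr0 !mul0r subr0.
have H (K : fieldType) (y : K) : y != 0 -> y / y ^+ 2 * (y / y ^+ 2) != 0.
  by move=> y0; rewrite !mulf_neq0 // invr_eq0 expf_neq0.
exact: H (coordF_neq0 C 0).
Qed.

(** The divisor [K + D_0 + D_1 + D_2] is principal: dividing the form by
    [dx_1 dx_2 / (x_1 x_2)], in the coordinates of the chart [x_0 = 1], leaves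
    a rational function with that divisor. *)
Lemma log_canonical_principal K : canonical_divisor K ->
  exists2 v : hfrac C, is_ratfun v &
    forall P, has_order P v (coeff P K + coeff P triangle).
Proof.
move=> [w hw]; have [h0 [rh0 _ w0 o0]] := hw 0; have [h1 [_ _ w1 o1]] := hw 1.
exists (h0 * ((x 1 / x 0) * (x 2%:R / x 0))).
  by apply: is_ratfunM => //; apply: is_ratfunM; apply: is_ratfun_coord.
(* The same function in the chart [x_1 = 1], which gives its order along
   the line [x_0 = 0]. *)
have E : h0 * ((x 1 / x 0) * (x 2%:R / x 0)) = - (h1 * ((x 0 / x 1) * (x 2%:R / x 1))).
  have := chart_form_glue C 1; move: (w1); rewrite w0.
  move=> /matrixP /(_ 1 2%:R); rewrite [LHS]mxE [RHS]mxE => e.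
  move=> /matrixP /(_ 1 2%:R); rewrite [LHS]mxE [RHS]mxE expr1 => g.
  exact: log_form_glue chart_form0_neq0 e (coordF_neq0 C 0) (coordF_neq0 C 1) g.
move=> P; rewrite coeff_triangle; pose d i : int := (coord_line C i == P)%:R.
rewrite -/(d 0) -/(d 1) -/(d 2%:R).
have ord i j : has_order P (x i / x j) (d i - d j).
  by apply: has_orderM; [|apply: has_orderV]; apply: has_order_coord.
have ordh i j k l h n : has_order P h n -> d j = 0 -> d l = 0 ->
    has_order P (h * ((x i / x j) * (x k / x l))) (n + (d i + d k)).
  move=> hn dj dl; have := has_orderM hn (has_orderM (ord i j) (ord k l)).
  by rewrite dj dl !subr0.
have [P0|P0] := eqVneq P (coord_line C 0); last first.
  have d0 : d 0 = 0 by rewrite /d eq_sym (negPf P0).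
  by rewrite d0 add0r; apply: ordh => //; apply: o0.
have P1 : P != coord_line C 1 by rewrite P0 (inj_eq coord_line_inj).
have d1 : d 1 = 0 by rewrite /d eq_sym (negPf P1).
by rewrite d1 addr0 E; apply/has_orderN/ordh => //; apply: o1.
Qed.

(** Proportional forms map the whole plane to a point. *)
Lemma proportional_not_embedding (N : nat) (h : 'I_N.+1 -> hpoly C) (G : hfrac C)
    (c : 'I_N.+1 -> C) :
  (forall j, (h j)%:F = ((c j)%:MP)%:F * G) -> ~ is_embedding h.
Proof.
move=> hG [nz inj _].
have e (i j : 'I_N.+1) : c i *: h j = c j *: h i.
  apply/eqP; rewrite -tofrac_eq -!mul_mpolyC !tofracM !hG; apply/eqP.
  by rewrite mulrCA.
have he i (v : 'rV[C]_3) j : c i * heval (h j) v = c j * heval (h i) v.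
  by rewrite /heval -!mevalZ e.
have n0 : delta_mx 0 0 != 0 :> 'rV[C]_3.
  by apply/eqP => /matrixP /(_ 0 0) /eqP; rewrite !mxE eqxx oner_eq0.
have n1 : delta_mx 0 1 != 0 :> 'rV[C]_3.
  by apply/eqP => /matrixP /(_ 0 1) /eqP; rewrite !mxE eqxx oner_eq0.
have [i ci0] : exists i, c i != 0.
  apply/existsP; apply/contraT; rewrite negb_exists => /forallP c0.
  have /negP[] := nz _ n0; apply/eqP/matrixP => k j; rewrite !mxE.
  have -> : h j = 0; last by rewrite /heval meval0.
  apply/eqP; rewrite -tofrac_eq0 hG; move: (c0 j); rewrite negbK => /eqP ->.
  by rewrite mpolyC0 tofrac0 mul0r.
have projE v : proj_map h v = (heval (h i) v / c i) *: \row_j c j.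
  apply/matrixP => k j; rewrite !mxE; apply: (mulfI ci0).
  by rewrite he mulrA mulrCA divff // mulr1 mulrC.
have hi v : v != 0 -> heval (h i) v != 0.
  by move/nz; apply: contraNneq => h0; rewrite projE h0 mul0r scale0r.
have [] := inj _ _ n0 n1 _.
  rewrite !projE; exists (heval (h i) (delta_mx 0 0) / heval (h i) (delta_mx 0 1)).
  by rewrite scalerA mulrA divfK // hi.
move=> a /matrixP /(_ 0 0) /eqP; rewrite !mxE mulr0.
by rewrite oner_eq0.
Qed.

(** The multiples of [- (K + D_0 + D_1 + D_2)] are principal, so their sections
    are the scalar multiples of a single one. *)
Lemma log_triangle_not_ample K : canonical_divisor K -> ~ ample (- (K + triangle)).
Proof.
move=> /log_canonical_principal[v rv ov] [m [_ [N [h [sec emb]]]]].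
set E := _ *+ m in sec *.
suff /choice[c hc] j : exists c : C, (h j)%:F = (c%:MP)%:F * (v ^+ m * div_equation E).
  exact: proportional_not_embedding hc emb.
have [f [[rf fE] hf]] := sec j.
have v0 : v != 0.
  have [a [b [Pa Pb vE]]] := ov (coord_line C 0).
  rewrite vE mulf_neq0 ?expfz_neq0 ?equationF_neq0 // mulf_neq0 // ?invr_eq0 tofrac_eq0;
  apply/eqP => z; [apply: Pa|apply: Pb]; exists 0; rewrite z mulr0 //.
case: fE => [f0|of_].
  by exists 0; rewrite hf f0 mpolyC0 tofrac0 !mul0r.
have [c cE] : exists c : C, f / v ^+ m = (c%:MP)%:F.
  apply: no_poles_const => [|P].
    by apply: is_ratfunM => //; apply/is_ratfunV/is_ratfunX.
  have [n [fn]] := of_ P; rewrite coeffMn coeffN coeffD mulNrn => n0.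
  have := has_orderM fn (has_orderV (has_orderX m (ov P))).
  by case: (_ - _) n0 => // k _ ?; exists k.
have vm0 : v ^+ m != 0 by exact: expf_neq0.
by exists c; rewrite -cE hf [RHS]mulrA (divfK vm0).
Qed.

End Boundary.

(** * Torus-invariant curves are coordinate lines *)

Section Torus.
Variable C : numClosedFieldType.
Implicit Types (P Q : prime_divisor C) (p q : hpoly C) (D : divisor C) (t : 'rV[C]_3).

(** The torus acts on each monomial by a character. *)
Lemma mcoeff_torus_pullback t p m :
  (torus_pullback t p)@_m = p@_m * \prod_i t 0 i ^+ m i.
Proof.
rewrite /torus_pullback comp_mpolyEX raddf_sum /=.
have E k : 'X_[k] \mPo [tuple t 0 i *: 'X_i | i < 3] =
    (\prod_i t 0 i ^+ k i) *: 'X_[k] :> hpoly C.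
  rewrite comp_mpolyX mpolyXE_id -mul_mpolyC rmorph_prod -big_split /=.
  by apply: eq_bigr => i _; rewrite tnth_mktuple exprZn -mul_mpolyC rmorphXn.
under eq_bigr => k _ do rewrite E scalerA mcoeffZ mcoeffX.
have [mp|mp] := boolP (m \in msupp p).
  rewrite (bigD1_seq m) ?msupp_uniq //= eqxx mulr1 [X in _ + X]big1 ?addr0 // => k km.
  by rewrite (negPf km) mulr0.
rewrite (memN_msupp_eq0 mp) mul0r big_seq big1 //= => k kp.
by case: eqP mp => [<-|_ _]; rewrite ?kp // mulr0.
Qed.

HB.instance Definition _ t := GRing.RMorphism.copy (@torus_pullback C t)
  (comp_mpoly [tuple t 0 i *: ('X_i : hpoly C) | i < 3]).

Lemma torus_pullbackK t : (forall i, t 0 i != 0) ->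
  cancel (@torus_pullback C t) (@torus_pullback C (\row_i (t 0 i)^-1)).
Proof.
move=> t0 p; apply/mpolyP => m; rewrite !mcoeff_torus_pullback -mulrA -big_split.
rewrite big1 ?mulr1 // => i _; rewrite /= mxE exprVn divff // expf_neq0 //.
Qed.

Lemma torus_pullbackX t i : torus_pullback t 'X_i = t 0 i *: 'X_i.
Proof. by rewrite /torus_pullback comp_mpolyXU -tnth_nth tnth_mktuple. Qed.

Lemma torus_pullbackZ t c p : torus_pullback t (c *: p) = c *: torus_pullback t p.
Proof. exact: comp_mpolyZ. Qed.

Lemma dhomog_torus_pullback t p d :
  p \is d.-homog -> torus_pullback t p \is d.-homog.
Proof.
move=> /dhomogP h; apply/dhomogP => m mt; apply: h; move: mt.
rewrite !mcoeff_msupp mcoeff_torus_pullback.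
by apply: contraNneq => ->; rewrite mul0r.
Qed.

Lemma irreducible_torus_pullback t p : (forall i, t 0 i != 0) ->
  mirreducible p -> mirreducible (torus_pullback t p).
Proof.
move=> t0 [p0 pU irr]; pose t' : 'rV[C]_3 := \row_i (t 0 i)^-1.
have K : cancel (@torus_pullback C t) (@torus_pullback C t').
  exact: torus_pullbackK.
have K' : cancel (@torus_pullback C t') (@torus_pullback C t).
  have -> : t = \row_i (t' 0 i)^-1 by apply/rowP => i; rewrite !mxE invrK.
  by apply: torus_pullbackK => i; rewrite mxE invr_eq0.
split.
- by rewrite -(rmorph0 (@torus_pullback C t)) (inj_eq (can_inj K)).
- apply: contraNN pU => /(rmorph_unit (@torus_pullback C t')).
  by rewrite /= K.
move=> q r e; have : p = torus_pullback t' q * torus_pullback t' r.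
  by rewrite -rmorphM -e /= K.
by case/irr => /(rmorph_unit (@torus_pullback C t)); rewrite /= K'; [left|right].
Qed.

(** An irreducible form with a single monomial is a variable. *)
Lemma two_monomials P : (forall i, P != coord_line C i) ->
  exists m m' i, [/\ (equation P)@_m != 0, (equation P)@_m' != 0 & m i != m' i].
Proof.
move=> Pi; pose m := mlead P.
have [[m' Pm' m'm]|H] := pselect (exists2 m', (equation P)@_m' != 0 & m' != m).
  have [i mi] : exists i, m i != m' i.
    apply/existsP; apply: contraR m'm; rewrite negb_exists => /forallP h.
    by apply/eqP/mnmP => i; move: (h i); rewrite negbK => /eqP.
  by exists m, m', i; split=> //; rewrite equation_leadc oner_eq0.
have PE : equation P = 'X_[m].
  apply/mpolyP => k; rewrite mcoeffX; have [<-|mk] := eqVneq m k.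
    exact: equation_leadc.
  by apply/eqP; apply: contra_notT H => Pk; exists k => //; rewrite eq_sym.
have [_ PU _] := equation_irr P.
have [i mi] : exists i, (m i != 0)%N.
  apply/existsP; apply: contraR PU; rewrite negb_exists => /forallP h.
  rewrite PE (_ : m = 0%MM) ?mpolyX0 ?unitr1 //.
  by apply/mnmP => i; move: (h i); rewrite negbK mnm0E => /eqP.
have /mdivides_eq E : mdivides (coord_line C i) P.
  exists 'X_[m - U_(i)]; rewrite /= PE -mpolyXD addmC submK // lep1mP //.
by have := Pi i; rewrite -E eqxx.
Qed.

(** The point [2 ^ k] of the one-parameter subgroup acting on the [i]-th
    coordinate only. *)
Definition dilation (i : 'I_3) (k : nat) : 'rV[C]_3 :=
  \row_j if j == i then 2%:R ^+ k else 1.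

Lemma prod_dilation i k (m : 'X_{1..3}) :
  \prod_j dilation i k 0 j ^+ m j = 2%:R ^+ (k * m i).
Proof.
rewrite (bigD1 i) //= mxE eqxx -exprM big1 ?mulr1 // => j ji.
by rewrite mxE (negPf ji) expr1n.
Qed.

(** A curve that is not a coordinate line has infinitely many translates under
    the torus, namely its images under the [dilation i k]. *)
Lemma torus_invariant_coord D P : torus_invariant D -> P \in dom D ->
  exists i, P = coord_line C i.
Proof.
move=> inv; rewrite mem_dom => PD.
have [[i /eqP Pi]|H] := pselect (exists i, P == coord_line C i); first by exists i.
have {}H i : P != coord_line C i by apply: contra_notN H => Pi; exists i.
have [m [m' [i [Pm Pm' mm']]]] := two_monomials H.
have [d hP] := equation_homog P.
have t0 k j : dilation i k 0 j != 0.
  by rewrite mxE; case: ifP => _; rewrite ?oner_eq0 // expf_neq0 // pnatr_eq0.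
have /choice[Q QE] k : exists Q, exists2 c : C, c != 0 &
    torus_pullback (dilation i k) P = c *: equation Q.
  have irr := irreducible_torus_pullback (t0 k) (equation_irr P).
  have [Q QE] := prime_divisor_ex irr (dhomog_torus_pullback (dilation i k) hP).
  have c0 : mleadc (torus_pullback (dilation i k) P) != 0.
    by rewrite mleadc_eq0; have [] := irr.
  exists Q, (mleadc (torus_pullback (dilation i k) P)) => //.
  by rewrite QE scalerA divff ?scale1r.
have QD k : Q k \in dom D.
  rewrite mem_dom -(inv _ (t0 k) P) //.
  by have [c _ e] := QE k; exists c.
have Qinj : injective Q.
  move=> k l kl; have [c c0 ck] := QE k; have [c' c'0 cl] := QE l.
  rewrite -kl in cl.
  have e : c' *: torus_pullback (dilation i k) P = c *: torus_pullback (dilation i l) P.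
    by rewrite ck cl !scalerA mulrC.
  (* The translates [k] and [l] coincide; compare the coefficients at [n]. *)
  have ex n : (equation P)@_n != 0 -> c' * 2%:R ^+ (k * n i) = c * 2%:R ^+ (l * n i).
    move=> Pn; apply: (mulfI Pn); have := congr1 (mcoeff n) e.
    rewrite !mcoeffZ !mcoeff_torus_pullback !prod_dilation.
    by rewrite mulrCA => ->; rewrite mulrCA.
  have : (2%:R ^+ (k * m i + l * m' i) : C) = 2%:R ^+ (l * m i + k * m' i).
    apply: (mulfI (mulf_neq0 c0 c'0)); rewrite !exprD.
    transitivity ((c' * 2%:R ^+ (k * m i)) * (c * 2%:R ^+ (l * m' i))); first by ring.
    by rewrite (ex m) // -(ex m') //; ring.
  rewrite -!natrX => /eqP; rewrite eqr_nat eqn_exp2l // => /eqP; nia.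
have uQ : uniq (map Q (iota 0 (size (dom D)).+1)).
  by rewrite map_inj_uniq // iota_uniq.
have sQ : {subset map Q (iota 0 (size (dom D)).+1) <= dom D}.
  by move=> _ /mapP[k _ ->].
by have := uniq_leq_size uQ sQ; rewrite size_map size_iota ltnn.
Qed.

End Torus.

(** * Sums of coordinate lines *)

Section CoordSums.
Variable C : numClosedFieldType.
Implicit Types (P Q : prime_divisor C) (p q : hpoly C) (D : divisor C) (t : 'rV[C]_3).
Implicit Types (S : {set 'I_3}).

Local Notation x i := (('X_i : hpoly C)%:F : hfrac C).

(** The sum of the coordinate lines with index in [S]. *)
Definition coord_sum S : divisor C := \sum_(i in S) coord_divisor C i.

Lemma coeff_coord_sum S P :
  coeff P (coord_sum S) = \sum_(i in S) (coord_line C i == P)%:R.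
Proof. by rewrite raddf_sum; apply: eq_bigr => i _; rewrite /= coeff_coord_divisor. Qed.

Lemma coeff_coord_sum_line S i : coeff (coord_line C i) (coord_sum S) = (i \in S)%:R.
Proof.
rewrite coeff_coord_sum; have [iS|iS] := boolP (i \in S).
  rewrite (bigD1 i) //= eqxx big1 ?addr0 // => j /andP[_ ji].
  by rewrite (inj_eq (@coord_line_inj C)) (negPf ji).
rewrite big1 // => j jS; rewrite (inj_eq (@coord_line_inj C)).
by case: eqP iS => // <-; rewrite jS.
Qed.

Lemma coeff_coord_sum0 S P : (forall i, P != coord_line C i) -> coeff P (coord_sum S) = 0.
Proof.
by move=> H; rewrite coeff_coord_sum big1 // => i _; rewrite eq_sym (negPf (H i)).
Qed.

Lemma coord_lineP P : (exists i, P = coord_line C i) \/ (forall i, P != coord_line C i).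
Proof.
have [[i Pi]|H] := pselect (exists i, P = coord_line C i); [by left; exists i|right=> i].
by apply: contra_notN H => /eqP ->; exists i.
Qed.

Lemma divisor_eq D D' : (forall i, coeff (coord_line C i) D = coeff (coord_line C i) D') ->
  (forall P, (forall i, P != coord_line C i) -> coeff P D = coeff P D') -> D = D'.
Proof.
move=> H1 H2; apply/eqP/freeg_eqP => P.
by case: (coord_lineP P) => [[i ->]|]; [apply: H1 | apply: H2].
Qed.

Lemma torus_invariant_sum D : reduced_divisor D -> torus_invariant D ->
  exists S, D = coord_sum S.
Proof.
move=> red inv; exists [set i | coord_line C i \in dom D].
apply: divisor_eq => [i|P H]; last first.
  rewrite coeff_coord_sum0 //; apply/eqP; rewrite -[_ == 0]negbK -mem_dom.
  apply/negP => PD; have [i /eqP] := torus_invariant_coord inv PD.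
  by rewrite (negPf (H i)).
rewrite coeff_coord_sum_line inE; have [iD|] := boolP (_ \in dom D); first exact: red.
by move/coeff_outdom.
Qed.

Lemma mem_dom_coord_sum S P :
  (P \in dom (coord_sum S)) = (P \in [seq coord_line C i | i <- enum S]).
Proof.
rewrite mem_dom; case: (coord_lineP P) => [[i ->]|H].
  by rewrite coeff_coord_sum_line mem_map ?mem_enum; [case: (i \in S)|exact: coord_line_inj].
rewrite coeff_coord_sum0 // eqxx; apply/esym/negbTE/negP => /mapP[i _ Pi].
by have := H i; rewrite Pi eqxx.
Qed.

Lemma perm_dom_coord_sum S : perm_eq (dom (coord_sum S)) [seq coord_line C i | i <- enum S].
Proof.
apply: uniq_perm; rewrite ?uniq_dom ?map_inj_uniq ?enum_uniq //.
  exact: coord_line_inj.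
exact: mem_dom_coord_sum.
Qed.

Lemma reduced_coord_sum S : reduced_divisor (coord_sum S).
Proof.
move=> P; rewrite mem_dom; case: (coord_lineP P) => [[i ->]|H].
  by rewrite coeff_coord_sum_line; case: (i \in S).
by rewrite coeff_coord_sum0 ?eqxx.
Qed.

Lemma torus_invariant_coord_sum S : torus_invariant (coord_sum S).
Proof.
move=> t t0 P Q [c e].
suff [->//|[H1 H2]] : P = Q \/
    (forall i, P != coord_line C i) /\ (forall i, Q != coord_line C i).
  by rewrite !coeff_coord_sum0.
case: (coord_lineP Q) => [[i Qi]|HQ].
  left; rewrite Qi; apply/esym/mdivides_eq; exists (c * (t 0 i)^-1)%:MP.
  have := congr1 (torus_pullback (\row_i (t 0 i)^-1)) e.
  rewrite torus_pullbackK // Qi torus_pullbackZ torus_pullbackX mxE => ->.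
  by rewrite scalerA [RHS]mulrC mul_mpolyC.
case: (coord_lineP P) => [[i Pi]|HP]; last by right.
left; rewrite Pi; apply/esym/mdivides_eq; exists (c / t 0 i)%:MP.
move: e; rewrite Pi /= torus_pullbackX => e.
by rewrite /= [RHS]mulrC mul_mpolyC [c / _]mulrC -scalerA -e scalerA mulVf // scale1r.
Qed.

Lemma hgrad_coord i (v : 'rV[C]_3) : hgrad ('X_i : hpoly C) v = delta_mx 0 i.
Proof.
apply/rowP => j; rewrite !mxE mderivXU /heval eqxx /= eq_sym.
by case: eqP; rewrite ?meval1 ?meval0.
Qed.

Lemma free_delta (s : seq 'I_3) : uniq s -> free [seq (delta_mx 0 i : 'rV[C]_3) | i <- s].
Proof.
move=> us; apply/(@freeP _ _ _ (in_tuple _)) => k /= H j.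
have js : (j < size s)%N by rewrite -(size_map (fun i => delta_mx 0 i : 'rV[C]_3)).
have /rowP/(_ (nth 0 s j)) := H; rewrite summxE mxE (bigD1 j) //= big1.
  by rewrite addr0 mxE (nth_map 0) // mxE !eqxx mulr1.
move=> i ij; have is_ : (i < size s)%N.
  by rewrite -(size_map (fun i => delta_mx 0 i : 'rV[C]_3)).
by rewrite mxE (nth_map 0) // mxE nth_uniq // eq_sym [_ == _ :> nat](negPf ij) mulr0.
Qed.

Lemma snc_coord_sum S : snc (coord_sum S).
Proof.
move=> v v0.
have pe : perm_eq
  [seq hgrad P v | P : prime_divisor C <- dom (coord_sum S) & heval P v == 0]
  [seq delta_mx 0 i | i <- enum S & v 0 i == 0].
  apply: perm_trans (perm_map _ (perm_filter _ (perm_dom_coord_sum S))) _.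
  rewrite filter_map -map_comp (@eq_filter _ _ (fun i => v 0 i == 0)); last first.
    by move=> i /=; rewrite /heval mevalXU.
  by rewrite (@eq_map _ _ _ (fun i => delta_mx 0 i)) // => i /=; rewrite hgrad_coord.
by rewrite (perm_free pe) free_delta // filter_uniq ?enum_uniq.
Qed.

End CoordSums.

(** * Sections, embeddings and the classification *)

Section Classification.
Variable C : numClosedFieldType.
Implicit Types (P Q : prime_divisor C) (p q : hpoly C) (D : divisor C).
Implicit Types (S : {set 'I_3}).

Local Notation x i := (('X_i : hpoly C)%:F : hfrac C).

(** An equation of [coord_sum C S]. *)
Definition coord_prod S : hpoly C := \prod_(i in S) 'X_i.

Lemma coord_prod_neq0 S : coord_prod S != 0.
Proof.
apply/prodf_neq0 => i _; exact: (equation_neq0 (coord_line C i)).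
Qed.

Lemma dhomog_coord i : ('X_i : hpoly C) \is 1.-homog.
Proof. by rewrite dhomogX /= mdeg1. Qed.

Lemma dhomog_coord_prod S : coord_prod S \is #|S|.-homog.
Proof.
rewrite /coord_prod mprodXE dhomogX /= (big_morph (@mdeg 3) (@mdegD 3) (@mdeg0 3)).
by under eq_bigr do rewrite mdeg1; rewrite sum1_card.
Qed.

Lemma has_order_coord_prod S P :
  has_order P (coord_prod S)%:F (coeff P (coord_sum C S)).
Proof.
rewrite coeff_coord_sum /coord_prod rmorph_prod /=.
apply: (big_ind2 (fun f n => has_order P f n)) => [|f m g n|i _].
- exact: has_order1.
- exact: has_orderM.
- exact: has_order_coord.
Qed.

Lemma div_equation_coord_sum S : div_equation (coord_sum C S) = (coord_prod S)%:F.
Proof.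
rewrite /div_equation (perm_big _ (perm_dom_coord_sum C S)) /= big_map big_enum /=.
rewrite /coord_prod rmorph_prod; apply: eq_bigr => i iS.
by rewrite coeff_coord_sum_line iS expr1z.
Qed.

(** Every nonzero form of degree [#|S|] is a section of [O(sum_(i in S) D_i)]. *)
Lemma global_section_coord_sum S p : p != 0 -> p \is #|S|.-homog ->
  global_section (coord_sum C S) p.
Proof.
move=> p0 hp; have c0 : (coord_prod S)%:F != 0 by rewrite tofrac_eq0 coord_prod_neq0.
exists (p%:F / (coord_prod S)%:F); split; last first.
  by rewrite div_equation_coord_sum (divfK c0).
split.
  exists #|S|, p, (coord_prod S); split=> //; first exact: dhomog_coord_prod.
  exact: coord_prod_neq0.
right=> P; have [n pn] := has_order_poly P p0.
exists (n%:Z - coeff P (coord_sum C S)); split; last by rewrite subrK.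
exact: has_orderM pn (has_orderV (has_order_coord_prod S P)).
Qed.

Lemma triangleE : triangle C = coord_sum C [set: 'I_3].
Proof.
rewrite /coord_sum (bigD1 0) ?inE //= (bigD1 1) ?inE //= (bigD1 2%:R) ?inE //= big1.
  by rewrite addr0 addrA.
by move=> i; case: (ord3P i) => ->; rewrite ?eqxx ?andbF.
Qed.

(** The form [dx_1 dx_2 / (x_1 x_2)] in the coordinates of the chart [x_0 = 1]
    has a simple pole along each coordinate line. *)
Lemma canonical_triangle : canonical_divisor (- coord_sum C [set: 'I_3]).
Proof.
set T := coord_prod [set: 'I_3].
have T0 : T%:F != 0 by rewrite tofrac_eq0 coord_prod_neq0.
exists (T%:F^-1 *: (x 0 ^+ 3 *: chart_form C 0)) => i.
exists ((-1) ^+ i * (x i ^+ 3 / T%:F)); split.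
- have r : is_ratfun (x i ^+ 3 / T%:F).
    exists 3, ('X_i ^+ 3), T; split; rewrite ?coord_prod_neq0 //.
    + exact: (dhomogMn 3 (dhomog_coord i)).
    + by have := dhomog_coord_prod [set: 'I_3]; rewrite cardsT card_ord.
    + by rewrite tofracXn.
  by rewrite -signr_odd mulr_sign; case: odd => //; apply: is_ratfunN.
- apply: mulf_neq0; first by rewrite signr_eq0.
  by apply: mulf_neq0; [exact/expf_neq0/coordF_neq0 | rewrite invr_eq0].
- rewrite -(chart_form_glue C i) scalerA; congr (_ *: _).
  by rewrite [LHS]mulrC [RHS]mulrA.
move=> P Pi; rewrite coeffN.
have o : has_order P (x i ^+ 3 / T%:F) (- coeff P (coord_sum C [set: 'I_3])).
  have := has_orderM (has_orderX 3 (has_order_coord P i))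
    (has_orderV (has_order_coord_prod [set: 'I_3] P)).
  by rewrite [_ == P]eq_sym (negPf Pi) mul0rn add0r.
by rewrite -signr_odd mulr_sign; case: odd => //; apply: has_orderN.
Qed.

Lemma neq0_coord (v : 'rV[C]_3) : v != 0 -> exists i, v 0 i != 0.
Proof.
move=> v0; apply/existsP; apply: contraR v0; rewrite negb_exists => /forallP H.
by apply/eqP/rowP => i; rewrite mxE; apply/eqP; have := H i; rewrite negbK.
Qed.

Lemma embedding_coord : @is_embedding C 2 (fun i => 'X_i).
Proof.
have E v : proj_map (fun i : 'I_3 => 'X_i : hpoly C) v = v.
  by apply/rowP => j; rewrite mxE /heval mevalXU.
split=> [v v0|u v _ _|v w v0]; rewrite !E //.
suff -> : proj_jacobian (fun i : 'I_3 => 'X_i : hpoly C) v = 1%:M by rewrite mulmx1.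
apply/matrixP => i j; rewrite !mxE mderivXU /heval eq_sym.
by case: eqP; rewrite ?meval1 ?meval0.
Qed.

(** The nine products [x_a x_b], i.e. the quadratic Veronese map (with
    repetitions), indexed by the base-3 digits [a] and [b]. *)
Definition veronese (k : 'I_9) : hpoly C := 'X_(inord (k %/ 3)) * 'X_(inord (k %% 3)).

Lemma veronese_index (a b : 'I_3) : exists k, veronese k = 'X_a * 'X_b.
Proof.
have ab : (a * 3 + b < 9)%N by case: a b => [a ha] [b hb] /=; lia.
exists (Ordinal ab); rewrite /veronese /= divnMDl // divn_small // addn0.
rewrite modnMDl modn_small //.
by rewrite !inord_val.
Qed.

Lemma embedding_veronese : @is_embedding C 8 veronese.
Proof.
have prodE v a b k : veronese k = 'X_a * 'X_b -> proj_map veronese v 0 k = v 0 a * v 0 b.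
  by move=> e; rewrite mxE e /heval mevalM !mevalXU.
split.
- move=> v /neq0_coord[a va]; apply/eqP => /rowP H.
  have [k ke] := veronese_index a a; have := H k.
  by rewrite (prodE _ _ _ _ ke) mxE => /eqP; rewrite mulf_eq0 orbb (negPf va).
- move=> u v /neq0_coord[a ua] _ [c /rowP H].
  exists (c * v 0 a / u 0 a); apply/rowP => b; have [k ke] := veronese_index a b.
  have := H k; rewrite [RHS]mxE !(prodE _ _ _ _ ke) => e; rewrite mxE.
  by apply: (mulfI ua); rewrite e; field.
move=> v w /neq0_coord[a va] [c /rowP H].
(* The differential, on the products by a coordinate [a] with [v 0 a != 0]. *)
have {}H b : w 0 a * v 0 b + v 0 a * w 0 b = c * (v 0 a * v 0 b).
  have [k ke] := veronese_index a b; have := H k.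
  rewrite [RHS]mxE (prodE _ _ _ _ ke) => <-; rewrite mxE.
  under eq_bigr => i _.
    rewrite mxE ke mderivM !mderivXU /heval mevalD !mevalM !mevalXU.
    over.
  have key (d : 'I_3) (y : C) :
      \sum_i w 0 i * (((d == i)%:R : hpoly C).@[fun i => v 0 i] * y) = w 0 d * y.
    rewrite (bigD1 d) //= eqxx meval1 mul1r big1 ?addr0 // => i id.
    by rewrite eq_sym (negPf id) meval0 mul0r mulr0.
  under eq_bigr => i _ do rewrite mulrDr.
  rewrite big_split /= key; congr (_ + _).
  by under eq_bigr => i _ do rewrite [v 0 a * _]mulrC; rewrite key mulrC.
exists (w 0 a / v 0 a); apply/rowP => b; rewrite mxE.
have Ha := H a; have Hb := H b.
have cE : c * v 0 a = w 0 a *+ 2.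
  by apply: (mulIf va); rewrite -mulrA -Ha; ring.
apply: (mulfI va); have -> : v 0 a * w 0 b = c * v 0 a * v 0 b - w 0 a * v 0 b.
  by rewrite -mulrA -Hb; ring.
by rewrite cE; field.
Qed.

Lemma ample_coord_sum S : (0 < #|S|)%N -> (#|S| < 3)%N -> ample (coord_sum C S).
Proof.
have X0 i : ('X_i : hpoly C) != 0 := equation_neq0 (coord_line C i).
case E: #|S| => [|[|[|//]]] // _ _; exists 1%N; split=> //; rewrite mulr1n.
  exists 2, (fun i => 'X_i); split; last exact: embedding_coord.
  by move=> i; apply: global_section_coord_sum; rewrite ?E ?dhomog_coord.
exists 8, veronese; split; last exact: embedding_veronese.
move=> k; apply: global_section_coord_sum; first exact: mulf_neq0.
by rewrite E; apply: (@dhomogM _ _ _ 1 _ 1); apply: dhomog_coord.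
Qed.

Lemma toric_coord_sum S : (0 < #|S|)%N -> (#|S| < 3)%N ->
  toric_log_del_Pezzo (coord_sum C S).
Proof.
move=> S0 S3; split; last exact: torus_invariant_coord_sum.
split; first by split; [exact: reduced_coord_sum | exact: snc_coord_sum].
exists (- coord_sum C [set: 'I_3]); split; first exact: canonical_triangle.
(* With [K = - (D_0 + D_1 + D_2)], the divisor [- (K + D)] is the sum of the
   lines outside [D]. *)
have -> : - (- coord_sum C [set: 'I_3] + coord_sum C S) = coord_sum C (~: S).
  rewrite opprD opprK; apply/eqP; rewrite subr_eq; apply/eqP.
  rewrite [LHS](bigID (mem S)) /= addrC; congr (_ + _).
    by apply: eq_bigl => i; rewrite !inE.
  by apply: eq_bigl => i; rewrite !inE.
have := cardsC S; rewrite card_ord => e.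
by apply: ample_coord_sum; lia.
Qed.

Lemma toric_log_del_PezzoP D : D != 0 ->
  toric_log_del_Pezzo D <->
  exists S, [/\ (0 < #|S|)%N, (#|S| < 3)%N & D = coord_sum C S].
Proof.
move=> D0; split=> [[[[red _] [K [hK aK]]] inv]|[S [S0 S3 ->]]]; last first.
  exact: toric_coord_sum.
have [S DS] := torus_invariant_sum red inv; exists S; split=> //.
  rewrite lt0n cards_eq0; apply: contraNneq D0 => S0.
  by rewrite DS S0 /coord_sum big_set0.
rewrite ltn_neqAle -[X in (_ <= X)%N](card_ord 3) max_card andbT.
apply/eqP => S3; have ST : S = [set: 'I_3].
  by apply/eqP; rewrite eqEcard subsetT cardsT card_ord S3.
by case: (log_triangle_not_ample hK); rewrite triangleE -ST -DS.
Qed.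

Lemma coord_sumE S : coord_sum C S = coord_divisor C 0 *+ (0 \in S) +
  coord_divisor C 1 *+ (1 \in S) + coord_divisor C 2%:R *+ (2%:R \in S).
Proof.
rewrite /coord_sum big_mkcond /= (bigD1 0) //= (bigD1 1) //= (bigD1 2%:R) //= big1.
  by rewrite addr0 addrA -!mulrb.
by move=> i; case: (ord3P i) => ->.
Qed.

Lemma toric_log_del_Pezzo_list D : D != 0 ->
  toric_log_del_Pezzo D <->
  D \in [:: coord_divisor C 0; coord_divisor C 1; coord_divisor C 2;
            coord_divisor C 0 + coord_divisor C 1;
            coord_divisor C 0 + coord_divisor C 2;
            coord_divisor C 1 + coord_divisor C 2].
Proof.
move=> D0; rewrite toric_log_del_PezzoP //; split=> [[S [S0 S3 ->]]|].
  have cS : #|S| = ((0%R \in S) + (1%R \in S) + (2%:R%R \in S))%N.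
    rewrite -sum1_card big_mkcond /= (bigD1 0%R) //= (bigD1 1%R) //= (bigD1 2%:R%R) //=.
    rewrite big1 ?addn0 ?addnA; first by do 3!case: (_ \in S).
    by move=> i; case: (ord3P i) => ->.
  rewrite coord_sumE; move: S0 S3; rewrite cS.
  by case: (0 \in S) (1 \in S) (2%:R \in S) => [] [] [] // _ _;
    rewrite ?mulr1n ?mulr0n ?addr0 ?add0r !inE eqxx ?orbT.
have s1 i : coord_divisor C i = coord_sum C [set i] by rewrite /coord_sum big_set1.
have s2 i j : i != j -> coord_divisor C i + coord_divisor C j = coord_sum C [set i; j].
  by move=> ij; rewrite /coord_sum big_setU1 ?inE //= big_set1.
have H S : (0 < #|S| < 3)%N ->
    exists S', [/\ (0 < #|S'|)%N, (#|S'| < 3)%N & coord_sum C S = coord_sum C S'].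
  by case/andP; exists S.
rewrite !inE => /or4P[/eqP->|/eqP->|/eqP->|/or3P[/eqP->|/eqP->|/eqP->]];
  rewrite ?s2 ?s1 //; apply: H; by rewrite ?cards1 ?cards2.
Qed.

End Classification.

Theorem theorem1p2 (R : realType) (D : divisor R[i]) (hD : D != 0) :
  toric_log_del_Pezzo D <->
  D \in [:: coord_divisor R[i] 0; coord_divisor R[i] 1; coord_divisor R[i] 2;
            coord_divisor R[i] 0 + coord_divisor R[i] 1;
            coord_divisor R[i] 0 + coord_divisor R[i] 2;
            coord_divisor R[i] 1 + coord_divisor R[i] 2].
Proof. exact: toric_log_del_Pezzo_list. Qed.
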